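(* There are bridgeless cubic graphs $G$ whose list normal chromatic index satisfies $\chi_{n,l}'(G) \ge 8$.
   Context: Graphs are finite and simple; a cubic graph is a $3$-regular graph, and a graph is bridgeless if it has no edge whose removal increases the number of connected components. A normal edge-coloring of a cubic graph $G$ is a proper edge-coloring such that, for every edge $e$, the set of colors appearing on the edges adjacent to $e$ has exactly four elements (then $e$ is called rich) or exactly two elements (then $e$ is called poor). A list assignment $L$ for $G$ assigns to each edge $e$ of $G$ a list (set) $L(e)$ of possible colors. The list normal chromatic index $\chi_{n,l}'(G)$ is the least $k$ such that, for every list assignment $L$ with $|L(e)|\ge k$ for every $e\in E(G)$, there is a normal edge-coloring $\varphi$ of $G$ with $\varphi(e)\in L(e)$ for every $e\in E(G)$. *)

(* Defs.v *)
From mathcomp Require Import all_boot finmap boolp.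

Set Implicit Arguments.
Unset Strict Implicit.
Unset Printing Implicit Defensive.

Record sgraph := SGraph {
  vertex :> finType;
  adj : rel vertex;
  adj_sym : symmetric adj;
  adj_irrefl : irreflexive adj }.

Definition edges (G : sgraph) : {set {set G}} :=
  [set [set p.1; p.2] | p : G * G & adj p.1 p.2].

Definition cubic (G : sgraph) : Prop :=
  forall x : G, #|[set y | adj x y]| = 3.

Definition del_edge (G : sgraph) (e : {set G}) : rel G :=
  [rel x y | adj x y && ([set x; y] != e)].

Definition bridge (G : sgraph) (e : {set G}) : bool :=
  (e \in edges G) && (n_comp (@adj G) G < n_comp (del_edge e) G).

Definition bridgeless (G : sgraph) : Prop := forall e : {set G}, ~~ bridge e.

Definition adj_edges (G : sgraph) (e : {set G}) : {set {set G}} :=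
  [set f in edges G | (f != e) && (e :&: f != set0)].

(* Edge colorings are functions on all vertex sets, of which only the values on
   [edges G] matter; likewise for list assignments below. Colors are natural
   numbers: a finite graph with finite lists involves finitely many colors. *)
Definition proper_coloring (G : sgraph) (phi : {set G} -> nat) : Prop :=
  {in edges G, forall e f, f \in adj_edges e -> phi e <> phi f}.

Definition adj_colors (G : sgraph) (phi : {set G} -> nat) (e : {set G}) :
  {fset nat} := [fset phi f | f in adj_edges e]%fset.

Definition rich (G : sgraph) (phi : {set G} -> nat) (e : {set G}) : bool :=
  #|` adj_colors phi e| == 4.

Definition poor (G : sgraph) (phi : {set G} -> nat) (e : {set G}) : bool :=
  #|` adj_colors phi e| == 2.

Definition normal_coloring (G : sgraph) (phi : {set G} -> nat) : Prop :=
  proper_coloring phi /\ {in edges G, forall e, rich phi e || poor phi e}.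

Definition normal_choosable (G : sgraph) (k : nat) : Prop :=
  forall L : {set G} -> {fset nat},
    {in edges G, forall e, k <= #|` L e|} ->
    exists2 phi : {set G} -> nat,
      normal_coloring phi & {in edges G, forall e, phi e \in L e}.

(* With #|edges G| colors per list all edges can receive distinct colors, and
   then every edge is rich; hence the minimum below is over a nonempty set. *)
Lemma list_injective_choice (T : eqType) (L : T -> {fset nat}) (s : seq T) :
  uniq s -> {in s, forall e, size s <= #|` L e|} ->
  exists2 phi : T -> nat,
    {in s &, injective phi} & {in s, forall e, phi e \in L e}.
Proof.
move=> + szL; have {szL} [k] : exists2 k, size s <= k &
    {in s, forall e, k <= #|` L e|} by exists (size s).
elim: s => [|a s IHs] /= szk szL; first by exists (fun=> 0).
case/andP=> a_s us; have [||//|phi phi_inj phiL] := IHs; first exact: ltnW.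
  by move=> e es; apply: szL; rewrite inE es orbT.
have [c cL c_s] : exists2 c, c \in L a & c \notin map phi s.
  apply: contrapT => noc.
  suff: #|` L a| <= size s by rewrite leqNgt (leq_trans szk) ?szL ?mem_head.
  rewrite -(size_map phi); apply: uniq_leq_size => // c cL.
  by case: (boolP (c \in map phi s)) => // c_s; case: noc; exists c.
exists (fun x => if x == a then c else phi x) => [x y|e].
  rewrite !inE; case: eqP => [->|_] /= xs; case: eqP => [->|_] //= ys.
  - by move=> cE; rewrite cE map_f in c_s.
  - by move=> cE; rewrite -cE map_f in c_s.
  - exact: phi_inj.
by rewrite inE; case: eqP => [->|_] //=; apply: phiL.
Qed.

Lemma card_adj_edges (G : sgraph) (e : {set G}) :
  cubic G -> e \in edges G -> #|adj_edges e| = 4.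
Proof.
move=> cubG /imsetP[[x y]]; rewrite inE /= => xy ->.
have neq (u v : G) : adj u v -> u != v.
  by apply: contraTneq => ->; rewrite adj_irrefl.
have edgeP (u v : G) : adj u v -> [set u; v] \in edges G.
  by move=> uv; apply/imsetP; exists (u, v); rewrite ?inE.
have inj2 (u v w : G) : [set u; v] = [set u; w] -> v = w.
  move=> /setP E; have := E v; have := E w; rewrite !inE !eqxx !orbT.
  by case: (eqVneq v w) => //= _; rewrite !orbF => /eqP-> /esym/eqP->.
pose S (u v : G) := [set [set u; z] | z in [set z | adj u z] :\ v].
have cS (u v : G) : adj u v -> #|S u v| = 2.
  move=> uv; rewrite card_imset => [|z w]; last exact: inj2.
  by have := cubG u; rewrite (cardsD1 v) inE uv => -[].
have -> : adj_edges [set x; y] = S x y :|: S y x.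
  apply/setP => f; rewrite !inE; apply/idP/idP.
    case/and3P=> /imsetP[[u v]]; rewrite inE /= => uv -> nE.
    case/set0Pn => z; rewrite !inE.
    have nE' : [set v; u] != [set x; y] by rewrite setUC.
    have vu : adj v u by rewrite adj_sym.
    have step (a b u' v' : G) : adj u' v' -> [set u'; v'] != [set a; b] ->
        u' = a -> [set u'; v'] \in S a b.
      move=> uv' nE'' ua; subst; apply/imsetP; exists v' => //.
      by rewrite !inE uv' andbT; apply: contraNneq nE'' => ->.
    case/andP=> /orP[]/eqP-> /orP[]/eqP zE; apply/orP.
    - by left; apply: step.
    - by left; rewrite setUC; apply: step.
    - by right; apply: step => //; rewrite [X in _ != X]setUC.
    - by right; rewrite setUC; apply: step => //; rewrite [X in _ != X]setUC.
  have step (a b : G) : f \in S a b ->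
      [&& f \in edges G, f != [set a; b] & [set a; b] :&: f != set0].
    case/imsetP => z; rewrite !inE => /andP[zb az] ->; rewrite edgeP //=.
    apply/andP; split; first by apply: contraNneq zb => /inj2->.
    by apply/set0Pn; exists a; rewrite !inE !eqxx.
  by case/orP=> /step //; rewrite [[set y; x]]setUC.
rewrite cardsU !cS // 1?adj_sym //; suff -> : S x y :&: S y x = set0.
  by rewrite cards0.
apply/setP => f; rewrite !inE; apply/negP => /andP[/imsetP[z]].
rewrite !inE => /andP[zy _] -> /imsetP[w _] /setP/(_ y).
by rewrite !inE eqxx /= eq_sym (negPf (neq _ _ xy)) eq_sym (negPf zy).
Qed.

Lemma normal_choosable_card_edges (G : sgraph) :
  cubic G -> normal_choosable G #|edges G|.
Proof.
move=> cubG L szL.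
have [||phi phi_inj phiL] := @list_injective_choice _ L (enum (edges G)).
- exact: enum_uniq.
- by move=> e; rewrite mem_enum -cardE; apply: szL.
have adjE (e f : {set G}) : f \in adj_edges e -> f \in edges G.
  by rewrite inE => /andP[].
exists phi => [|e eG]; last by apply: phiL; rewrite mem_enum.
split=> [e eG f fe /phi_inj|e eG].
  rewrite !mem_enum => /(_ eG (adjE _ _ fe)) ef.
  by move: fe; rewrite inE ef eqxx andbF.
apply/orP; left; rewrite /rich /adj_colors card_in_imfset /=.
  by rewrite -cardE card_adj_edges.
by move=> f g /= fe ge; apply: phi_inj; rewrite mem_enum (adjE e).
Qed.

Lemma normal_choosable_exists (G : sgraph) :
  cubic G -> exists k, `[< normal_choosable G k >].
Proof.
by move=> /normal_choosable_card_edges cG; exists #|edges G|; apply/asboolP.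
Qed.

Definition list_normal_index (G : sgraph) (cubG : cubic G) : nat :=
  ex_minn (normal_choosable_exists cubG).

(* Main.v *)
Require Import Defs.
From mathcomp Require Import all_boot.
From mathcomp Require Import ssralg zmodp finmap boolp.

(** The witness is the Wagner graph (the Moebius ladder on eight vertices, with
    rim 0, 1, ..., 7 and spokes joining antipodal vertices).

    Lists can forbid poor edges.  Around a poor edge only two colors occur, each
    once at either end; so an edge is rich as soon as one of its neighbors has a
    color that none of its other neighbors has ([unique_color_rich]).  Choose a
    set N of edges such that every edge of the graph is adjacent to an edge of
    N, and give each edge of N a list disjoint from all other lists.  Then every
    edge is rich in every normal coloring from these lists; in other words, any
    two distinct edges that are adjacent, or adjacent to a common edge, have
    distinct colors.  If the graph has more than k edges outside N that are
    pairwise in this position, then giving them all the same list of k colors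
    leaves no normal coloring ([crowded_not_normal_choosable]).

    In the Wagner graph every rim edge is within this distance of all edges, and
    the only pairs of edges that are too far apart are the two pairs of
    perpendicular spokes, 04, 26 and 15, 37.  For N = {04, 01, 37, 67}, which
    meets both pairs, the remaining eight edges are pairwise close, and every
    edge is adjacent to N.  Hence lists of seven colors do not suffice. *)

Set Implicit Arguments.
Unset Strict Implicit.
Unset Printing Implicit Defensive.

(** * Edges as pairs of endpoints *)

Section Edges.

Variable G : sgraph.
Implicit Types (p q : G * G) (e f : {set G}).

Definition edge_of p : {set G} := [set p.1; p.2].

Lemma edge_ofP e :
  reflect (exists2 p, adj p.1 p.2 & e = edge_of p) (e \in edges G).
Proof.
by apply: (iffP imsetP) => -[p]; rewrite ?inE => pG ->; exists p; rewrite ?inE.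
Qed.

Lemma edges_set2 (x y : G) : adj x y -> [set x; y] \in edges G.
Proof. by move=> xy; apply/edge_ofP; exists (x, y). Qed.

Lemma adj_neq (x y : G) : adj x y -> x != y.
Proof. by apply: contraTneq => ->; rewrite adj_irrefl. Qed.

(** Equality of finite sets does not reduce to a truth value by computation;
    the next two tests on endpoints do. *)
Definition same_edge p q : bool :=
  [&& p.1 \in [:: q.1; q.2], p.2 \in [:: q.1; q.2],
      q.1 \in [:: p.1; p.2] & q.2 \in [:: p.1; p.2]].

Definition touching p q : bool :=
  ~~ same_edge p q &&
  ((p.1 \in [:: q.1; q.2]) || (p.2 \in [:: q.1; q.2])).

Lemma edge_of_eq p q : (edge_of p == edge_of q) = same_edge p q.
Proof.
by rewrite /same_edge eqEsubset !subUset !sub1set !inE -!andbA.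
Qed.

Lemma touching_adj_edges p q :
  adj q.1 q.2 -> touching p q -> edge_of q \in adj_edges (edge_of p).
Proof.
move=> qG /andP[npq pq]; rewrite inE edges_set2 // eq_sym edge_of_eq npq /=.
apply/set0Pn; case/orP: pq => pq; [exists p.1 | exists p.2].
  by move: pq; rewrite !inE eqxx.
by move: pq; rewrite !inE eqxx orbT.
Qed.

Lemma edge_two_ends f (u v : G) :
  f \in edges G -> u \in f -> v \in f -> u != v -> f = [set u; v].
Proof.
case/edge_ofP=> -[x y] _ ->; rewrite !inE /=.
case/orP=> /eqP-> /orP[]/eqP->; rewrite ?eqxx // => _.
by rewrite /edge_of setUC.
Qed.

Lemma adj_edges_neq_end e f :
  e \in edges G -> f \in adj_edges e ->
  exists u v : G, [/\ adj v u, e = [set u; v] & v \notin f].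
Proof.
case/edge_ofP=> -[x y] /= xy ->; rewrite inE => /and3P[fG fe _].
have [xf|xf] := boolP (x \in f); last first.
  by exists y, x; rewrite xy /edge_of setUC.
exists x, y; rewrite adj_sym xy; split=> //; apply: contra fe => yf.
by rewrite (edge_two_ends fG xf yf) ?adj_neq.
Qed.

End Edges.

(** * Rich edges and forbidden poor edges *)

Section RichEdges.

Variable G : sgraph.
Hypothesis cubG : cubic G.
Variable phi : {set G} -> nat.
Implicit Types e f g h : {set G}.

(** In a cubic graph an edge has exactly four neighbors, so four colors among
    them leave no room for a repetition. *)
Lemma rich_inj e :
  e \in edges G -> rich phi e -> {in adj_edges e &, injective phi}.
Proof.
move=> eG /eqP rich_e f g fe ge fg; apply: contrapT => /eqP nfg.
suff: #|` adj_colors phi e| <= #|adj_edges e :\ f|.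
  have := card_adj_edges cubG eG; rewrite (cardsD1 f) fe add1n.
  by rewrite rich_e => -[->].
have -> : adj_colors phi e = [fset phi h | h in adj_edges e :\ f]%fset.
  apply/fsetP => c; apply/imfsetP/imfsetP => -[h /= he ->].
    have [->|nhf] := eqVneq h f; last by exists h; rewrite //= !inE nhf in he *.
    by exists g; rewrite //= in_setD1 eq_sym nfg.
  by exists h => //=; move: he; rewrite in_setD1 => /andP[].
by apply: leq_trans (leq_imfset_card _ _ _) _; rewrite /= cardE.
Qed.

(** The end of [e] that is not on [f] carries two more edges.  They have
    distinct colors, and with the color of [f] this makes three colors around
    [e], one more than a poor edge has. *)
Lemma unique_color_rich e f :
  normal_coloring phi -> e \in edges G -> f \in adj_edges e ->
  {in edges G, forall g, phi g = phi f -> g = f} -> rich phi e.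
Proof.
move=> [proper_phi normal_phi] eG fe uniq_f.
have /orP[//|/eqP poor_e] := normal_phi e eG.
have [u [v [vu eE vf]]] := adj_edges_neq_end eG fe.
have /card_gt1P[x [y []]] : 1 < #|[set z | adj v z] :\ u|.
  by have := cubG v; rewrite (cardsD1 u) inE vu add1n => -[->].
rewrite !inE => /andP[xu vx] /andP[yu vy] xy.
have at_v z : adj v z -> z != u ->
    [/\ [set v; z] \in edges G, [set v; z] \in adj_edges e
      & phi f != phi [set v; z]].
  move=> vz zu; have zG := edges_set2 vz; split=> //.
    rewrite inE zG eE /=; apply/andP; split.
      apply: contraNneq zu => /setP/(_ z); rewrite !inE eqxx orbT.
      by rewrite [z == v]eq_sym (negPf (adj_neq vz)) orbF => /esym.
    by apply/set0Pn; exists v; rewrite !inE !eqxx orbT.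
  apply: contraNneq vf => /esym /(uniq_f _ zG) <-.
  by rewrite !inE eqxx.
have [xG xe fx] := at_v x vx xu; have [yG ye fy] := at_v y vy yu.
have phi_xy : phi [set v; x] != phi [set v; y].
  apply/eqP; apply: (proper_phi _ xG); rewrite inE yG /=; apply/andP; split.
    apply: contraNneq xy => /setP/(_ x); rewrite !inE eqxx orbT.
    by rewrite [x == v]eq_sym (negPf (adj_neq vx)).
  by apply/set0Pn; exists v; rewrite !inE !eqxx.
have : ([fset phi f; phi [set v; x]; phi [set v; y]]
          `<=` adj_colors phi e)%fset.
  apply/fsubsetP => c; rewrite !inE -orbA => /or3P[]/eqP->;
    exact: in_imfset.
move/fsubset_leq_card; rewrite poor_e -fsetUA cardfsU1 cardfs2 !inE.
by rewrite (negPf fx) (negPf fy) phi_xy.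
Qed.

End RichEdges.

(** * Lists that make every edge rich *)

Definition color_block (k i : nat) : {fset nat} :=
  [fset c in iota (i * k) k]%fset.

Lemma card_color_block k i : #|` color_block k i| = k.
Proof. by rewrite card_fseq undup_id ?iota_uniq ?size_iota. Qed.

Lemma color_blocks_disjoint k i j c :
  c \in color_block k i -> c \in color_block k j -> i = j.
Proof.
have divE m : c \in color_block k m -> c %/ k = m.
  rewrite !inE mem_iota => /andP[lo hi]; have k_gt0 : 0 < k.
    by rewrite lt0n; apply: contraTneq hi => k0; rewrite k0 addn0 -leqNgt -k0.
  apply/eqP; rewrite eqn_leq leq_divRL // lo andbT -ltnS ltn_divLR //.
  by rewrite mulSn addnC.
by move=> /divE <- /divE <-.
Qed.

(** The edge in position [i] of [N] gets block [i], and all edges outside [N]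
    share the last block, since their [index] in [N] is [size N]. *)
Lemma crowded_not_normal_choosable (G : sgraph) (N S : seq {set G}) (k : nat) :
    cubic G ->
    {in edges G, forall e, exists2 f, f \in N & f \in adj_edges e} ->
    uniq S -> {subset S <= edges G} -> {in S, forall e, e \notin N} ->
    {in S &, forall f g, f != g ->
      (g \in adj_edges f) \/
      exists2 e, e \in edges G & (f \in adj_edges e) && (g \in adj_edges e)} ->
    k < size S ->
  ~ normal_choosable G k.
Proof.
move=> cubG domN uniqS SG SN closeS kS choosable.
have [e _|phi normal_phi phiL] :=
    choosable (fun e => color_block k (index e N)).
  by rewrite card_color_block.
have uniqN e : e \in edges G -> e \in N ->
    {in edges G, forall f, phi f = phi e -> f = e}.
  move=> eG eN f fG fe; have := phiL f fG; rewrite fe.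
  move=> /color_blocks_disjoint/(_ (phiL e eG)) idx.
  by rewrite -(nth_index e eN) -idx nth_index // -index_mem idx index_mem.
have rich_phi e : e \in edges G -> {in adj_edges e &, injective phi}.
  move=> eG; have [f fN fe] := domN e eG.
  have fG : f \in edges G by move: fe; rewrite inE => /andP[].
  apply: (rich_inj cubG eG); apply: (unique_color_rich cubG _ eG fe) => //.
  exact: uniqN.
have phi_inj : {in S &, injective phi}.
  move=> f g fS gS fg; apply: contrapT => /eqP nfg.
  have [gf|[e eG /andP[fe ge]]] := closeS f g fS gS nfg.
    have [proper_phi _] := normal_phi.
    by apply: (proper_phi f _ g gf); rewrite ?SG.
  by move: nfg; rewrite (rich_phi e eG f g fe ge fg) eqxx.
suff: size S <= k by rewrite leqNgt kS.
rewrite -(size_map phi) -(size_iota (size N * k) k).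
apply: uniq_leq_size => [|c /mapP[e eS ->]]; first by rewrite map_inj_in_uniq.
have := phiL e (SG e eS); rewrite inE /=.
suff -> : index e N = size N by [].
apply: anti_leq; rewrite index_size /=.
by have := SN e eS; rewrite -index_mem -leqNgt.
Qed.

(** * Bridgeless graphs *)

(** If every edge x y lies on a 4-cycle x, a, b, y, deleting an edge does not
    change which vertices are connected: the rest of the cycle is a detour. *)
Lemma four_cycles_bridgeless (G : sgraph) :
    (forall x y : G, adj x y -> exists a b : G,
      [/\ adj x a, adj a b, adj b y, a != y & b != x]) ->
  bridgeless G.
Proof.
move=> cyc e; rewrite /bridge negb_and -leqNgt; apply/orP; right.
suff eq_conn : connect (del_edge e) =2 connect (@adj G).
  by rewrite (eq_n_comp eq_conn).
have del_conn x y : adj x y -> connect (del_edge e) x y.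
  have [<-|ne] := eqVneq [set x; y] e => xy; last first.
    by rewrite connect1 //= /del_edge /= xy.
  have [a [b [xa ab by_ ay bx]]] := cyc x y xy.
  have kept u v : adj u v -> (u != x) && (u != y) || (v != x) && (v != y) ->
      connect (del_edge [set x; y]) u v.
    move=> uv far; apply: connect1; rewrite /del_edge /= uv /=.
    apply: contraTneq far => /setP uvE.
    have := uvE u; have := uvE v; rewrite !inE !eqxx orbT /= -!negb_or.
    by move=> <- <-.
  have ax : a != x by rewrite eq_sym adj_neq.
  have b_neq_y : b != y by apply: adj_neq.
  apply: connect_trans (kept x a xa _) _; first by rewrite ax ay orbT.
  apply: connect_trans (kept a b ab _) (kept b y by_ _); first by rewrite ax ay.
  by rewrite bx b_neq_y.
move=> x y; apply/idP/idP; apply: connect_sub => u v; last exact: del_conn.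
by case/andP=> uv _; apply: connect1.
Qed.

(** * The Wagner graph *)

Section Wagner.
Import GRing.Theory.
Local Open Scope ring_scope.

Definition wagner_adj (x y : 'Z_8) : bool := y - x \in [:: 1; -1; 4%:R].

Definition wagner_vertices : seq 'Z_8 := [seq inZp i | i <- iota 0 8].

(** Reduces a claim about all vertices to a computation: the enumeration of a
    finite type is locked, whereas [wagner_vertices] evaluates. *)
Lemma wagner_all (P : pred 'Z_8) : all P wagner_vertices -> forall x, P x.
Proof.
move=> /allP allP_ x; apply: allP_; apply/mapP; exists (x : nat).
  by rewrite mem_iota ltn_ord.
by rewrite valZpK.
Qed.

Lemma wagner_sym : symmetric wagner_adj.
Proof.
move=> x y; rewrite /wagner_adj -opprB; move: (x - y) => d.
by apply/eqP; move: d; apply: wagner_all; vm_compute.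
Qed.

Lemma wagner_irrefl : irreflexive wagner_adj.
Proof. by move=> x; rewrite /wagner_adj subrr. Qed.

Definition wagner : sgraph := SGraph wagner_sym wagner_irrefl.

Lemma wagner_cubic : cubic wagner.
Proof.
move=> x.
have -> : [set y : wagner | adj x y] = [set x + d | d in [:: 1; -1; 4%:R]].
  apply/setP => y; rewrite inE /= /wagner_adj; apply/idP/imsetP.
    by exists (y - x) => //; rewrite addrC subrK.
  by case=> d dS ->; rewrite addrC addKr.
rewrite card_imset; last exact: addrI.
by apply/card_uniqP.
Qed.

(** The rim edge from i to i + 1 and the spoke from i to i + 4 both lie on the
    4-cycle i, i + 1, i + 5, i + 4. *)
Lemma wagner_bridgeless : bridgeless wagner.
Proof.
apply: four_cycles_bridgeless => x y xy.
pose detour (x y a b : wagner) :=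
  [&& adj x a, adj a b, adj b y, a != y & b != x].
have : has (fun a => has (detour x y a) wagner_vertices) wagner_vertices.
  apply/implyP: xy; move: y; apply: wagner_all; move: x; apply: wagner_all.
  by vm_compute.
by case/hasP=> a _ /hasP[b _ /and5P[*]]; exists a, b.
Qed.

Definition wagner_edge (i j : nat) : wagner * wagner := (inZp i, inZp j).

(** The set N of the introduction; [crowd] lists all other edges. *)
Definition private_edges : seq (wagner * wagner) :=
  [:: wagner_edge 0 4; wagner_edge 0 1; wagner_edge 3 7; wagner_edge 6 7].

Definition crowd : seq (wagner * wagner) :=
  [:: wagner_edge 1 2; wagner_edge 2 3; wagner_edge 3 4; wagner_edge 4 5;
      wagner_edge 5 6; wagner_edge 7 0; wagner_edge 1 5; wagner_edge 2 6].

Lemma private_dominating (x y : wagner) :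
  adj x y -> has (touching (x, y)) private_edges.
Proof.
apply/implyP; move: y; apply: wagner_all; move: x; apply: wagner_all.
by vm_compute.
Qed.

Lemma crowd_close :
  {in crowd &, forall p q, [|| same_edge p q, touching p q
    | has (fun r => touching r p && touching r q) (crowd ++ private_edges)]}.
Proof. by apply/allrelP; vm_compute. Qed.

End Wagner.

Theorem theorem5p2 :
  exists (G : sgraph) (cubG : cubic G), bridgeless G /\ 8 <= list_normal_index cubG.
Proof.
exists wagner, wagner_cubic; split; first exact: wagner_bridgeless.
rewrite /list_normal_index; case: ex_minnP => k /asboolP choosable _.
rewrite leqNgt; apply/negP => k_lt8; move: choosable.
have adjP p : p \in crowd ++ private_edges -> adj p.1 p.2.
  by move: p; apply/allP; vm_compute.
have adj_crowd p : p \in crowd -> adj p.1 p.2.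
  by move=> pS; apply: adjP; rewrite mem_cat pS.
have adj_private p : p \in private_edges -> adj p.1 p.2.
  by move=> pN; apply: adjP; rewrite mem_cat pN orbT.
apply: (@crowded_not_normal_choosable wagner
          (map (@edge_of wagner) private_edges)
          (map (@edge_of wagner) crowd)) => //.
- exact: wagner_cubic.
- move=> _ /edge_ofP[[x y] xy ->].
  have /hasP[q qN pq] := private_dominating xy.
  exists (edge_of q); first exact: map_f.
  by apply: touching_adj_edges => //; apply: adj_private.
- rewrite map_inj_in_uniq; first by vm_compute.
  move=> p q pS qS /eqP; rewrite edge_of_eq => pq; apply/eqP.
  have /allrelP same_eq :
      allrel (fun p q => same_edge p q ==> (p == q)) crowd crowd.
    by vm_compute.
  exact: implyP (same_eq p q pS qS) pq.
- by move=> _ /mapP[p pS ->]; apply: edges_set2; apply: adj_crowd.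
- move=> _ /mapP[p pS ->]; apply/mapP => -[q qN] /eqP; rewrite edge_of_eq.
  have /allrelP disj : allrel (fun p q => ~~ same_edge p q) crowd private_edges.
    by vm_compute.
  by apply/negP; apply: disj.
move=> _ _ /mapP[p pS ->] /mapP[q qS ->]; rewrite edge_of_eq => /negPf npq.
have := crowd_close pS qS; rewrite npq orFb => /orP[pq|/hasP[r rG /andP[rp rq]]].
  by left; apply: touching_adj_edges => //; apply: adj_crowd.
right; exists (edge_of r); first exact/edges_set2/adjP.
by rewrite !touching_adj_edges ?adj_crowd.
Qed.
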